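(* The following three classes of fields coincide: (a) the class of fields $K$ such that for any commutative ring $I$ satisfying $I = I^2$ and any ideal extension $R$ of $I$ by $K$, the ring $R$ is commutative; (b) the class of fields $K$ such that for any ring $R$ and any central ideal $I$ of $R$ satisfying $R/I \simeq K$, the ring $R$ is commutative; (c) the class of fields $K$ such that there do not exist a field $L$ containing $K$ and two derivations from $K$ to $L$ whose kernels are incomparable with respect to inclusion. Moreover, when restricted to fields of characteristic zero, these classes coincide with the class of fields (of characteristic zero) having transcendence degree at most one over their prime subfields.
   Context: All rings are associative but not necessarily with unity; ideals are two-sided; $\simeq$ denotes ring isomorphism. An ideal extension of a ring $I$ by a ring $Q$ is a ring $R$ which contains an ideal $I'$ isomorphic (as a ring) to $I$ such that $R/I' \simeq Q$. An ideal $I$ of $R$ is central if it is contained in the center $Z(R)$. $I^2$ denotes the additive subgroup generated by all products $ij$ with $i,j\in I$. For a field $L$ containing $K$, a derivation $d : K \to L$ is a map with $d(x+y) = d(x)+d(y)$ and $d(xy) = x\,d(y) + d(x)\,y$ for all $x,y \in K$; its kernel is $\{r\in K \mid d(r)=0\}$. Two kernels are incomparable if neither is contained in the other. *)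

(* Defs.v *)
From HB Require Import structures.
From mathcomp Require Import all_boot all_algebra.
From mathcomp Require Import mpoly.

Set Implicit Arguments.
Unset Strict Implicit.
Unset Printing Implicit Defensive.

Import GRing.Theory.
Local Open Scope ring_scope.
Local Open Scope quotient_scope.

(* MathComp rings are unital; a rngType is an associative ring, not
   necessarily commutative and not necessarily with unity. *)
HB.mixin Record Zmodule_isRng R of GRing.Zmodule R := {
  rmul : R -> R -> R;
  rmulA : associative rmul;
  rmulDl : left_distributive rmul +%R;
  rmulDr : right_distributive rmul +%R
}.

#[short(type="rngType")]
HB.structure Definition Rng := {R of Zmodule_isRng R & GRing.Zmodule R}.

Declare Scope rng_scope.
Delimit Scope rng_scope with rng.
Infix "*" := rmul : rng_scope.

(* A unital ring with its unity forgotten; an alias of the carrier, so that the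
   instance below is only found on demand. *)
Definition rng_of (R : pzRingType) : Type := R.

HB.instance Definition _ (R : pzRingType) := GRing.Zmodule.on (rng_of R).
HB.instance Definition _ (R : pzRingType) :=
  Zmodule_isRng.Build (rng_of R) (@mulrA R) (@mulrDl R) (@mulrDr R).

Lemma rmulBl (R : rngType) (x y z : R) : rmul (x - y) z = rmul x z - rmul y z.
Proof. by apply/eqP; rewrite eq_sym subr_eq -rmulDl subrK. Qed.

Lemma rmulBr (R : rngType) (x y z : R) : rmul z (x - y) = rmul z x - rmul z y.
Proof. by apply/eqP; rewrite eq_sym subr_eq -rmulDr subrK. Qed.

Definition rng_commutative (R : rngType) : Prop := commutative (@rmul R).

Definition rng_iso (R S : rngType) : Prop :=
  exists f : R -> S,
    [/\ {morph f : x y / x + y}, {morph f : x y / (x * y)%rng} & bijective f].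

HB.mixin Record isRngIdeal (R : rngType) (I : R -> bool) := {
  rng_idealM : forall x y : R, y \in (I : pred R) ->
    (rmul x y \in (I : pred R)) /\ (rmul y x \in (I : pred R))
}.

#[short(type="rngIdeal")]
HB.structure Definition RngIdeal (R : rngType) :=
  {I of GRing.ZmodClosed R I & isRngIdeal R I}.

Section IdealTheory.
Variables (R : rngType) (I : rngIdeal R).

Lemma rng_idealMr (x y : R) : y \in I -> rmul x y \in I.
Proof. by case/(@rng_idealM R I x y). Qed.

Lemma rng_idealMl (x y : R) : y \in I -> rmul y x \in I.
Proof. by case/(@rng_idealM R I x y). Qed.

End IdealTheory.

Section IdealRng.
Variables (R : rngType) (I : rngIdeal R).

Record ideal_rng := IdealRng { ideal_val : R; ideal_valP : ideal_val \in I }.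

HB.instance Definition _ := [isSub for ideal_val].
HB.instance Definition _ := [Choice of ideal_rng by <:].
HB.instance Definition _ := [SubChoice_isSubZmodule of ideal_rng by <:].

Definition ideal_mul (x y : ideal_rng) : ideal_rng :=
  IdealRng (rng_idealMr (ideal_val x) (ideal_valP y)).

Fact ideal_mulA : associative ideal_mul.
Proof. by move=> x y z; apply/val_inj; rewrite /= rmulA. Qed.

Fact ideal_mulDl : left_distributive ideal_mul +%R.
Proof. by move=> x y z; apply/val_inj; rewrite /= rmulDl. Qed.

Fact ideal_mulDr : right_distributive ideal_mul +%R.
Proof. by move=> x y z; apply/val_inj; rewrite /= rmulDr. Qed.

HB.instance Definition _ :=
  Zmodule_isRng.Build ideal_rng ideal_mulA ideal_mulDl ideal_mulDr.

End IdealRng.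

(* The quotient of R by I: the library provides the additive quotient group
   Quotient.quot I, and the multiplication is added here. *)
Section QuotientRng.
Variables (R : rngType) (I : rngIdeal R).

Local Notation Q := (Quotient.quot I).

Definition quot_mul : Q -> Q -> Q := lift_op2 Q (@rmul R).

Fact pi_quot_mul : {morph \pi_Q : x y / rmul x y >-> quot_mul x y}.
Proof.
move=> x y; unlock quot_mul; apply/eqP; rewrite eq_sym -Quotient.idealrBE.
rewrite -[rmul (repr _) _](addrNK (rmul x (repr (\pi_Q y)))) -rmulBl.
rewrite -addrA -rmulBr rpredD //.
  by rewrite rng_idealMl // Quotient.idealrBE reprK.
by rewrite rng_idealMr // Quotient.idealrBE reprK.
Qed.
Canonical pi_quot_mul_morph := PiMorph2 pi_quot_mul.

Fact quot_mulA : associative quot_mul.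
Proof. by move=> x y z; rewrite -[x]reprK -[y]reprK -[z]reprK !piE rmulA. Qed.

Fact quot_mulDl : left_distributive quot_mul +%R.
Proof.
by move=> x y z; rewrite -[x]reprK -[y]reprK -[z]reprK !piE rmulDl.
Qed.

Fact quot_mulDr : right_distributive quot_mul +%R.
Proof.
by move=> x y z; rewrite -[x]reprK -[y]reprK -[z]reprK !piE rmulDr.
Qed.

HB.instance Definition _ :=
  Zmodule_isRng.Build Q quot_mulA quot_mulDl quot_mulDr.

End QuotientRng.

Definition quot_rng (R : rngType) (I : rngIdeal R) : rngType := Quotient.quot I.

Definition ideal_extension (I Q R : rngType) : Prop :=
  exists I' : rngIdeal R, rng_iso I (ideal_rng I') /\ rng_iso (quot_rng I') Q.

Definition central (R : rngType) (I : rngIdeal R) : Prop :=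
  forall x y : R, x \in I -> (x * y = y * x)%rng.

(* I^2, the additive subgroup generated by the products. *)
Inductive in_square (I : rngType) : I -> Prop :=
| in_square_mul x y : in_square (x * y)%rng
| in_square0 : in_square 0
| in_squareB x y : in_square x -> in_square y -> in_square (x - y).

Definition rng_idempotent (I : rngType) : Prop := forall x : I, in_square x.

Definition idempotent_extensions_commutative (K : fieldType) : Prop :=
  forall I : rngType, rng_commutative I -> rng_idempotent I ->
  forall R : rngType, ideal_extension I (rng_of K) R -> rng_commutative R.

Definition central_extensions_commutative (K : fieldType) : Prop :=
  forall (R : rngType) (I : rngIdeal R), central I ->
  rng_iso (quot_rng I) (rng_of K) -> rng_commutative R.

(* L is regarded as an extension of K through the embedding iota. *)
Definition derivation (K L : fieldType) (iota : {rmorphism K -> L})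
    (d : K -> L) : Prop :=
  {morph d : x y / x + y} /\
  forall x y : K, d (x * y) = iota x * d y + d x * iota y.

Definition kernels_incomparable (K L : fieldType) (d1 d2 : K -> L) : Prop :=
  ~ (forall x, d1 x = 0 -> d2 x = 0) /\ ~ (forall x, d2 x = 0 -> d1 x = 0).

Definition no_incomparable_derivations (K : fieldType) : Prop :=
  ~ exists (L : fieldType) (iota : {rmorphism K -> L}) (d1 d2 : K -> L),
      [/\ derivation iota d1, derivation iota d2 & kernels_incomparable d1 d2].

Definition prime_subfield (K : fieldType) (x : K) : Prop :=
  forall S : {pred K}, divring_closed S -> x \in S.

Section TranscendenceDegree.
Variables (K : fieldType) (F : K -> Prop).

(* F is meant to be (the carrier of) a subfield of K. *)
Definition alg_independent (B : K -> Prop) : Prop :=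
  forall (n : nat) (v : 'I_n -> K), injective v -> (forall i, B (v i)) ->
  forall p : {mpoly K[n]}, (forall m, F p@_m) -> p.@[v] = 0 -> p = 0.

Definition transcendence_basis (B : K -> Prop) : Prop :=
  alg_independent B /\
  forall B' : K -> Prop, alg_independent B' -> (forall x, B x -> B' x) ->
  forall x, B' x -> B x.

Definition has_trdeg (n : nat) : Prop :=
  exists s : seq K,
    [/\ uniq s, size s = n & transcendence_basis (fun x => x \in s)].

End TranscendenceDegree.

(* Main.v *)
(* The cycle is (a) -> (c) -> (b) -> (a).
   (b) -> (a): an idempotent commutative ideal is central, since
   r(ij) = (ri)j = j(ri) = (jr)i = i(jr) = (ij)r.
   (c) -> (b): if R/I = K with I central, then I kills every commutator, so
   commutators live in a K-vector space on which [x, y] is a biderivation of K.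
   A functional that does not vanish on [x0, y0] turns [x0, -] and [y0, -] into
   derivations K -> K with incomparable kernels.
   (a) -> (c): for derivations d1, d2 with incomparable kernels, d1 a * d2 b is
   a 2-cocycle that is not symmetric. Placing it in the annihilator of an
   idempotent commutative ring J, modelled on the Puiseux series of positive
   order modulo those of order > 1, gives a noncommutative extension of J by K.
   In characteristic zero, derivations with prescribed values on an
   algebraically independent family exist: a derivation is a subring of the dual
   numbers K[e] that is the graph of a function on K, and a maximal graph is
   defined on all of K. Conversely, if a derivation kills an independent family
   but not x, then the family remains independent when x is added, so every
   derivation is determined by its values on a transcendence basis. *)

Require Import Defs.
From HB Require Import structures.
From mathcomp Require Import all_boot all_algebra mpoly ring zify.
From mathcomp Require Import boolp classical_sets functions.

Set Implicit Arguments.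
Unset Strict Implicit.
Unset Printing Implicit Defensive.

Import GRing.Theory.
Local Open Scope ring_scope.
Local Open Scope quotient_scope.

(** * Ring extensions of fields *)

Section RngTheory.
Variable R : rngType.
Implicit Types x y z : R.

Lemma rmul0 x : rmul 0 x = 0.
Proof. by rewrite -(subrr x) rmulBl !subrr. Qed.

Lemma rmulr0 x : rmul x 0 = 0.
Proof. by rewrite -(subrr x) rmulBr !subrr. Qed.

Lemma rmulNr x y : rmul x (- y) = - rmul x y.
Proof. by rewrite -[- y]sub0r rmulBr rmulr0 sub0r. Qed.

Definition rcomm x y := rmul x y - rmul y x.

Lemma rcommE x y : rcomm x y = 0 -> rmul x y = rmul y x.
Proof. by move/eqP; rewrite subr_eq0 => /eqP. Qed.

Lemma rcommxx x : rcomm x x = 0. Proof. exact: subrr. Qed.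

Lemma rcommC x y : rcomm x y = - rcomm y x.
Proof. by rewrite opprB. Qed.

Lemma rcommDl x y z : rcomm (x + y) z = rcomm x z + rcomm y z.
Proof. by rewrite /rcomm rmulDl rmulDr opprD addrACA. Qed.

Lemma rcommBl x y z : rcomm (x - y) z = rcomm x z - rcomm y z.
Proof. by rewrite /rcomm rmulBl rmulBr !opprD !opprK addrACA. Qed.

Lemma rcommDr x y z : rcomm z (x + y) = rcomm z x + rcomm z y.
Proof. by rewrite rcommC rcommDl opprD -!(rcommC z). Qed.

End RngTheory.

Lemma morph_zmod (R S : zmodType) (f : R -> S) :
  {morph f : x y / x + y} -> f 0 = 0 /\ {morph f : x y / x - y}.
Proof.
move=> fD; have f0 : f 0 = 0 by apply: (addrI (f 0)); rewrite -fD !addr0.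
split=> // x y; apply: (addIr (f y)).
by rewrite -fD !subrK.
Qed.

Lemma idempotent_ideal_central (I R : rngType) (J : rngIdeal R) :
  rng_commutative I -> rng_idempotent I -> rng_iso I (ideal_rng J) ->
  central J.
Proof.
move=> Icomm Iidem [f [fD fM [g fK gK]]].
have Jcomm x y : x \in J -> y \in J -> rmul x y = rmul y x.
  move=> Jx Jy; have := Icomm (g (IdealRng Jx)) (g (IdealRng Jy)).
  by move/(congr1 f); rewrite !fM !gK => /(congr1 val).
have [f0 fB] := morph_zmod fD.
suff cent u r : in_square u -> rmul (val (f u)) r = rmul r (val (f u)).
  by move=> x y Jx; have := cent (g (IdealRng Jx)) y (Iidem _); rewrite gK.
elim=> [x y||x y _ IHx _ IHy].
- rewrite fM /=; have [Jx Jy] := (valP (f x), valP (f y)).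
  set i := ideal_val _ in Jx *; set j := ideal_val _ in Jy *.
  rewrite -rmulA (Jcomm i) ?rng_idealMl // -rmulA (Jcomm j) ?rng_idealMr //.
  by rewrite -rmulA.
- by rewrite f0 raddf0 rmul0 rmulr0.
by rewrite fB raddfB rmulBl rmulBr IHx IHy.
Qed.

Lemma central_extensions_idempotent (K : fieldType) :
  central_extensions_commutative K -> idempotent_extensions_commutative K.
Proof.
move=> Kb I Icomm Iidem R [J [IJ RJ]].
exact: Kb (idempotent_ideal_central Icomm Iidem IJ) RJ.
Qed.

(** * Commutators modulo a central kernel, and the derivations they yield *)

Section CentralExtension.
Variables (K : fieldType) (R : rngType) (p : R -> K).
Implicit Types x y z : R.
Hypothesis pD : {morph p : x y / x + y}.
Hypothesis pM : {morph p : x y / rmul x y >-> x * y}.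
Variable s : K -> R.
Hypothesis sK : cancel s p.
Hypothesis ker_central : forall x y, p x = 0 -> rmul x y = rmul y x.

Let p0 : p 0 = 0. Proof. exact: (morph_zmod pD).1. Qed.
Let pB : {morph p : x y / x - y}. Proof. exact: (morph_zmod pD).2. Qed.

(** Both [i] and [ix] lie in the kernel, hence are central: (ix)y = y(ix) = (yi)x = i(yx). *)
Lemma ker_mul_rcomm i x y : p i = 0 -> rmul i (rcomm x y) = 0.
Proof.
move=> pi0; have pix0 : p (rmul i x) = 0 by rewrite pM pi0 mul0r.
rewrite /rcomm rmulBr rmulA (ker_central y pix0) [rmul i (rmul y x)]rmulA.
by rewrite (ker_central y pi0) rmulA subrr.
Qed.

Lemma p_rcomm x y : p (rcomm x y) = 0.
Proof. by rewrite pB !pM mulrC subrr. Qed.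

(** The usual Leibniz rule has [x, z]y as its second term; [x, z] is in the kernel of [p], so the
    two factors commute. *)
Lemma rcommM x y z :
  rcomm (rmul x y) z = rmul x (rcomm y z) + rmul y (rcomm x z).
Proof.
rewrite -[rmul y (rcomm x z)]ker_central ?p_rcomm // /rcomm rmulBr rmulBl.
by rewrite !rmulA addrA subrK.
Qed.

Lemma mul_rcomm_modker x x' y z :
  p x = p x' -> rmul x (rcomm y z) = rmul x' (rcomm y z).
Proof.
move=> pxx'; apply/eqP; rewrite -subr_eq0 -rmulBl ker_mul_rcomm //.
by rewrite pB pxx' subrr.
Qed.

Lemma rcomm_modker x x' y : p x = p x' -> rcomm x y = rcomm x' y.
Proof.
move=> pxx'; apply/eqP; rewrite -subr_eq0 -rcommBl /rcomm ker_central ?subrr //.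
by rewrite pB pxx' subrr.
Qed.

(** [R] may lack a unity, so the lift e = [s 1] stands in for it. With c = [e, z], the congruence of
    ee and e modulo the kernel gives c = ec + ec; multiplying by e gives ec = ec + ec, so ec = 0 and
    c = 0. Then [x, y] = [ex, y] = e[x, y] + x[e, y] = e[x, y]. *)
Lemma rmul1_rcomm x y : rmul (s 1) (rcomm x y) = rcomm x y.
Proof.
have e_rcomm0 z : rcomm (s 1) z = 0.
  have ee : p (rmul (s 1) (s 1)) = p (s 1) by rewrite pM sK mulr1.
  have := rcommM (s 1) (s 1) z; rewrite (rcomm_modker _ ee) => eE.
  move: (mul_rcomm_modker (s 1) z ee) eE; move: (rcomm (s 1) z) => c eec cE.
  suff ec0 : rmul (s 1) c = 0 by rewrite cE ec0 addr0.
  by apply: (addrI (rmul (s 1) c)); rewrite addr0 -{1 2}eec -!rmulA -rmulDr -cE.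
have ex : p (rmul (s 1) x) = p x by rewrite pM sK mul1r.
by rewrite -[RHS](rcomm_modker _ ex) rcommM e_rcomm0 rmulr0 addr0.
Qed.

Section Functional.
Variables x0 y0 : R.
Local Notation v := (rcomm x0 y0).
Hypothesis v_neq0 : v <> 0.

(** The left ideals missing [v], and also the empty set: it is the union of the empty chain, so
    Zorn's lemma requires it to qualify. *)
Let avoiding (W : set R) :=
  [/\ forall a b, W a -> W b -> W (a - b), forall r a, W a -> W (rmul r a)
    & ~ W v].

Lemma maximal_avoiding : exists2 W, avoiding W &
  forall W', avoiding W' -> (W `<=` W')%classic -> W' = W.
Proof.
have [F Fav Ftot|W [Wav Wmax]] := @Zorn_bigcup R avoiding.
  split=> [a b [X FX Xa] [Y FY Yb]|r a [X FX Xa]|[X FX Xv]].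
  - have [XY|YX] := Ftot X Y FX FY.
      by exists Y => //; case: (Fav Y FY) => YB _ _; apply: YB => //; exact: XY.
    by exists X => //; case: (Fav X FX) => XB _ _; apply: XB => //; exact: YX.
  - by exists X => //; case: (Fav X FX) => _ XM _; exact: XM.
  - by case: (Fav X FX) => _ _.
exists W => // W' W'av WW'; apply: contrapT => neqW.
by apply: (Wmax W') => //; split => // W'W; apply: neqW; apply/seteqP.
Qed.

(** For a maximal left ideal [W] missing [v], each commutator is congruent modulo [W] to a unique
    multiple of [v]. [phi x y k] says that this coefficient of [x, y] is [k]; the third clause is
    linearity over [K], which acts on commutators through arbitrary lifts. *)
Lemma coefficient_functional : exists phi : R -> R -> K -> Prop,
  [/\ forall x y, exists k, phi x y k,
      forall x y k k', phi x y k -> phi x y k' -> k = k',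
      forall x y x' y' r r' z w k k', phi x y k -> phi x' y' k' ->
        rcomm z w = rmul r (rcomm x y) + rmul r' (rcomm x' y') ->
        phi z w (p r * k + p r' * k')
    & phi x0 y0 1].
Proof.
have [W [WB WM Wv] Wmax] := maximal_avoiding.
(* A maximal [W] is not empty, since the zero ideal would be larger. *)
have W0 : W 0.
  have [[w Ww]|Wno] := pselect (exists w, W w).
    by rewrite -(subrr w); apply: WB.
  have : avoiding [set 0].
    split=> [_ _ -> ->|r _ ->|/v_neq0//]; first by rewrite subr0.
    exact: rmulr0.
  by move/Wmax <- => // w Ww; case: Wno; exists w.
have WD a b : W a -> W b -> W (a + b).
  by move=> Wa Wb; rewrite -[b]opprK -[- b]sub0r; apply/WB/WB.
have sMv r x y : rmul (s (p r)) (rcomm x y) = rmul r (rcomm x y).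
  by apply: mul_rcomm_modker; rewrite sK.
have W_unit k : k != 0 -> ~ W (rmul (s k) v).
  move=> k0 /(WM (s k^-1)); rewrite rmulA (@mul_rcomm_modker _ (s 1)).
    by rewrite rmul1_rcomm.
  by rewrite pM !sK mulVf.
exists (fun x y k => W (rcomm x y - rmul (s k) v)); split.
- move=> x y; set u := rcomm x y.
  have [Wu|nWu] := pselect (W u).
    (* [s 0] need not be 0, but it lies in the kernel of [p] and so annihilates [v]. *)
    exists 0; apply: WB => //; rewrite ker_mul_rcomm //.
  (* [W'] = W + Ru contains [u], so by maximality it contains [v] = w + ru. Here [p r] is nonzero,
     and its inverse is the coefficient of [u]. *)
  pose W' : set R := fun w' => exists w r, W w /\ w' = w + rmul r u.
  have WW' : (W `<=` W')%classic.
    by move=> w Ww; exists w, 0; rewrite rmul0 addr0.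
  have W'B a b : W' a -> W' b -> W' (a - b).
    move=> [w [r [Ww ->]]] [w1 [r1 [Ww1 ->]]]; exists (w - w1), (r - r1).
    by split; [apply: WB | rewrite rmulBl opprD addrACA].
  have W'M r a : W' a -> W' (rmul r a).
    move=> [w [r1 [Ww ->]]]; exists (rmul r w), (rmul r r1).
    by split; [apply: WM | rewrite rmulDr rmulA].
  have W'u : W' u by exists 0, (s 1); rewrite add0r rmul1_rcomm.
  have [[w [r [Ww vE]]]|nW'v] := pselect (W' v); last first.
    by case: nWu; rewrite -(Wmax W').
  have [pr0|pr0] := eqVneq (p r) 0.
    by case: Wv; rewrite vE ker_mul_rcomm // addr0.
  exists (p r)^-1; rewrite vE rmulDr rmulA (@mul_rcomm_modker _ (s 1)).
    rewrite rmul1_rcomm opprD addrCA subrr addr0 -sub0r.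
    by apply: WB => //; apply: WM.
  by rewrite pM !sK mulVf.
- move=> x y k k' Wk Wk'; apply/eqP; rewrite -subr_eq0; apply: contrapT => nk.
  apply: (@W_unit (k - k')); first exact/negP.
  have := WB _ _ Wk' Wk; rewrite opprB addrC addrA subrK -rmulBl.
  by rewrite (@mul_rcomm_modker _ (s (k - k'))) // pB !sK.
- move=> x y x' y' r r' z w k k' Wk Wk' ->.
  rewrite (@mul_rcomm_modker (s _) (rmul r (s k) + rmul r' (s k'))); last first.
    by rewrite pD !pM !sK.
  rewrite rmulDl opprD addrACA -!rmulA -!rmulBr.
  by apply: WD; apply: WM.
- by rewrite rmul1_rcomm subrr.
Qed.

End Functional.

Lemma noncommutative_derivations :
  no_incomparable_derivations K -> rng_commutative R.
Proof.
move=> Kc x0 y0; apply: rcommE; apply: contrapT => v_neq0; apply: Kc.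
have [phi [phiE phi_inj phiL phi1]] := coefficient_functional v_neq0.
have phi0 x : phi x x 0.
  have [k phik] := phiE x x.
  have <- : p 0 * k + p 0 * k = 0 by rewrite p0 mul0r addr0.
  by apply: phiL (phik) (phik) _; rewrite rcommxx !rmul0 addr0.
(* For fixed [z], the coefficient of [z, y] depends only on [p y], which makes it a function on [K];
   the Leibniz rule for commutators makes it a derivation. *)
have D_der z : exists2 d : K -> K, derivation idfun d &
    forall y k, phi z y k -> d (p y) = k.
  have [d dP] : exists d : K -> K, forall c, phi z (s c) (d c).
    by have [//|d dP] := @boolp.choice _ _ (fun c => phi z (s c)); exists d.
  have rcommr y y' : p y = p y' -> rcomm z y = rcomm z y'.
    by move=> yy'; rewrite rcommC (rcomm_modker _ yy') -rcommC.
  have dE y k : phi z y k -> d (p y) = k.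
    move=> phik; apply: (phi_inj z y) => //.
    have <- : p (s 1) * d (p y) + p (s 0) * d (p y) = d (p y).
      by rewrite !sK mul1r mul0r addr0.
    apply: phiL (dP _) (dP _) _; rewrite rmul1_rcomm.
    by rewrite ker_mul_rcomm ?sK // addr0; apply: rcommr; rewrite sK.
  exists d => //; split=> [c c'|c c'] /=.
    rewrite -[c + c']sK; apply: dE.
    have <- : p (s 1) * d c + p (s 1) * d c' = d c + d c' by rewrite sK !mul1r.
    apply: phiL (dP _) (dP _) _; rewrite !rmul1_rcomm -rcommDr.
    by apply: rcommr; rewrite pD !sK.
  have <- : p (s c) * d c' + p (s c') * d c = c * d c' + d c * c'.
    by rewrite !sK [d c * _]mulrC.
  rewrite -[c * c']sK; apply: dE.
  apply: phiL (dP _) (dP _) _; rewrite -[rcomm z (s (c * c'))]opprK -rcommC.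
  rewrite (@rcomm_modker _ (rmul (s c) (s c'))) ?pM ?sK // rcommM.
  by rewrite opprD -!rmulNr -!rcommC.
have [dx dx_der dxE] := D_der x0; have [dy dy_der dyE] := D_der y0.
(* [dx] vanishes at [p x0] because [x0, x0] = 0, whereas [dy] is -1 there because [y0, x0] = -v. At
   [p y0] the values are 1 for [dx] and 0 for [dy]. *)
exists K, idfun, dx, dy; split=> //; split=> dxy.
  have /eqP := dxy (p x0) (dxE _ _ (phi0 _)).
  rewrite (dyE _ (p x0 * 0 - 1)).
    by rewrite mulr0 sub0r oppr_eq0 oner_eq0.
  have -> : p x0 * 0 - 1 = p (- s 1) * 1 + p 0 * 1.
    by rewrite -[- s 1]sub0r pB !p0 sK mulr0 !sub0r mul0r addr0 mulr1.
  apply: phiL (phi1) (phi1) _.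
  by rewrite rmul0 addr0 -[- s 1]sub0r rmulBl rmul0 sub0r rmul1_rcomm -rcommC.
have /eqP := dxy (p y0) (dyE _ _ (phi0 _)).
by rewrite (dxE _ 1) // oner_eq0.
Qed.

End CentralExtension.

Lemma no_incomparable_derivations_central (K : fieldType) :
  no_incomparable_derivations K -> central_extensions_commutative K.
Proof.
move=> Kc R I Icent [f [fD fM [g fK gK]]].
pose p (x : R) : K := f (\pi_(Quotient.quot I) x).
pose s c : R := repr (g c).
apply: (@noncommutative_derivations K R p _ _ s) => //.
- by move=> x y; rewrite /p raddfD fD.
- by move=> x y; rewrite /p pi_quot_mul fM.
- by move=> c; rewrite /p /s reprK gK.
move=> x y px0; apply: Icent.
rewrite -[x]subr0 Quotient.idealrBE; apply/eqP/(can_inj fK).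
by rewrite raddf0 (morph_zmod fD).1.
Qed.

(** * Ideal extensions from short exact sequences and from 2-cocycles *)

Lemma ideal_extension_exact (I Q R : rngType) (i : I -> R) (q : R -> Q) :
    {morph i : x y / x + y} -> {morph i : x y / rmul x y} -> injective i ->
    {morph q : x y / x + y} -> {morph q : x y / rmul x y} ->
    (forall c, exists x, q x = c) ->
    (forall x, q x = 0 <-> exists u, x = i u) ->
  ideal_extension I Q R.
Proof.
move=> iD iM i_inj qD qM q_surj qi.
have [[i0 iB] [q0 qB]] := (morph_zmod iD, morph_zmod qD).
pose J : R -> bool := fun x => q x == 0.
have JZ : zmod_closed (J : {pred R}).
  split=> [|x y]; rewrite /in_mem /= /J ?q0 ?eqxx //.
  by move=> /eqP qx /eqP qy; rewrite qB qx qy subrr.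
have JM x y : y \in (J : pred R) ->
    rmul x y \in (J : pred R) /\ rmul y x \in (J : pred R).
  by rewrite /in_mem /= /J !qM => /eqP ->; rewrite rmul0 rmulr0 eqxx.
pose Ji : rngIdeal R :=
  HB.pack J (GRing.isZmodClosed.Build R J JZ) (isRngIdeal.Build R J JM).
exists Ji; split.
  have iJ u : i u \in Ji by apply/eqP/qi; exists u.
  exists (fun u => IdealRng (iJ u)).
  split=> [x y|x y|]; try by apply: val_inj => /=; rewrite ?iD ?iM.
  have [x|g gP] := @boolp.choice _ _ (fun (x : ideal_rng Ji) u => val x = i u).
    by apply/qi/eqP/(valP x).
  exists g => [u|x]; first by apply: i_inj; rewrite -gP.
  by apply: val_inj; rewrite /= -gP.
have [g gP] := boolp.choice q_surj.
have qpi x : q (repr (\pi_(Quotient.quot Ji) x)) = q x.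
  apply/eqP; rewrite eq_sym -subr_eq0 -qB -[_ == 0]/(_ \in Ji).
  by rewrite Quotient.idealrBE reprK.
exists (fun u : Quotient.quot Ji => q (repr u)); split.
- by move=> x y; rewrite -[x]reprK -[y]reprK -raddfD !qpi qD.
- move=> x y.
  transitivity (q (repr (\pi_(Quotient.quot Ji) (rmul (repr x) (repr y))))).
    by rewrite pi_quot_mul !reprK.
  by rewrite qpi qM.
exists (fun c => \pi_(Quotient.quot Ji) (g c)) => [u|c]; last by rewrite qpi.
rewrite -[RHS]reprK; apply/eqP; rewrite -Quotient.idealrBE.
by apply/eqP; rewrite qB gP subrr.
Qed.

(* [f] is a Hochschild 2-cocycle with values in the annihilator of [J]. *)
Lemma cocycle_extension (K : fieldType) (J : rngType) (act : K -> J -> J)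
    (f : K -> K -> J) :
    (forall a, {morph act a : u v / u + v}) ->
    (forall a b u, act (a + b) u = act a u + act b u) ->
    (forall a b u, act (a * b) u = act a (act b u)) ->
    (forall a u v, act a (rmul u v) = rmul (act a u) v) ->
    (forall a u v, act a (rmul u v) = rmul u (act a v)) ->
    (forall a b c, f (a + b) c = f a c + f b c) ->
    (forall a b c, f a (b + c) = f a b + f a c) ->
    (forall a b c, act a (f b c) + f a (b * c) = f (a * b) c + act c (f a b)) ->
    (forall a b u, rmul (f a b) u = 0) -> (forall a b u, rmul u (f a b) = 0) ->
  exists2 R : rngType, ideal_extension J (rng_of K) R &
    rng_commutative R -> forall a b, f a b = f b a.
Proof.
move=> actD actDl actM actMl actMr fDl fDr fC f0 f0r.
(* The product (a, u)(b, v) = (ab, av + bu + uv + f(a, b)), twisted by the cocycle. *)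
pose mul (x y : K * J) : K * J :=
  (x.1 * y.1, (act x.1 y.2 + act y.1 x.2) + (rmul x.2 y.2 + f x.1 y.1)).
have act0r a : act a 0 = 0 := (morph_zmod (actD a)).1.
have act0 u : act 0 u = 0.
  by apply: (addrI (act 0 u)); rewrite -actDl !addr0.
have f00 a : f a 0 = 0 by apply: (addrI (f a 0)); rewrite -fDr !addr0.
have f00l a : f 0 a = 0 by apply: (addrI (f 0 a)); rewrite -fDl !addr0.
have mulA : associative mul.
  move=> [a u] [b v] [c w]; congr (_, _) => /=; first exact: mulrA.
  rewrite !actD !rmulDl !rmulDr f0 f0r !addr0 -!actM -!actMl -!actMr.
  rewrite [c * a]mulrC [c * b]mulrC !rmulA.
  (* The rearrangement isolates the two terms in [f], to which the cocycle identity applies; the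
     other seven agree on both sides. *)
  rewrite [LHS](AC (2*2*1*4) ((4*9)*(1*2*5*7*3*6*8))) /= fC.
  by rewrite [RHS](AC (1*(2*2)*4) ((9*5)*(1*2*3*4*6*7*8))).
have mulDl : left_distributive mul +%R.
  move=> [a u] [b v] [c w]; congr (_, _) => /=; first exact: mulrDl.
  by rewrite actD actDl rmulDl fDl
    [LHS](AC ((2*2)*(2*2)) (((1*3)*(5*7))*((2*4)*(6*8)))).
have mulDr : right_distributive mul +%R.
  move=> [a u] [b v] [c w]; congr (_, _) => /=; first exact: mulrDr.
  by rewrite actD actDl rmulDr fDr
    [LHS](AC ((2*2)*(2*2)) (((1*3)*(5*7))*((2*4)*(6*8)))).
pose R : rngType := HB.pack (K * J)%type
  (Zmodule_isRng.Build (K * J)%type mulA mulDl mulDr).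
exists R.
  apply: (@ideal_extension_exact J (rng_of K) R (fun u => (0, u)) fst) => //.
  - by move=> u v; congr (_, _); rewrite /= addr0.
  - move=> u v; rewrite -[RHS]/(mul (0, u) (0, v)) /mul /=.
    by rewrite mul0r f00 !act0 !add0r addr0.
  - by move=> u v [].
  - by move=> c; exists (c, 0).
  - by move=> [a u]; split=> [/= ->|[v [-> _]]]; first by exists u.
move=> Rcomm a b; have : mul (a, 0) (b, 0) = mul (b, 0) (a, 0) := Rcomm _ _.
move/(congr1 snd); by rewrite /= !act0r rmul0 !add0r.
Qed.

(** * An idempotent commutative ring with nonzero annihilator *)

Section PuiseuxGerms.
Variable L : fieldType.

Local Notation A := (rng_of (nat -> {poly L})).

(** [e k n] is the order required at level [n]. With 2 ^ (n - k) the condition reads: order at least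
    2 ^ -k in x, so an existential [k] expresses positive order. *)
Definition eventually_dvd (e : nat -> nat -> nat) (p : A) : Prop :=
  exists k, forall n, (k <= n)%N -> 'X^(e k n) %| p n.

Lemma eventually_dvd_zmod e :
  (forall k k' n, (k <= k')%N -> e k' n <= e k n)%N ->
  zmod_closed ((fun p => `[< eventually_dvd e p >]) : {pred A}).
Proof.
move=> e_anti; split=> [|p q /asboolP[k kP] /asboolP[l lP]].
  by apply/asboolP; exists 0%N => n _; exact: dvdp0.
apply/asboolP; exists (maxn k l) => n; rewrite geq_max => /andP[kn ln].
apply: dvdp_sub.
  by apply: dvdp_trans (kP n kn); rewrite dvdp_exp2l // e_anti // leq_maxl.
by apply: dvdp_trans (lP n ln); rewrite dvdp_exp2l // e_anti // leq_maxr.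
Qed.

Lemma eventually_dvd_mul e p q :
  eventually_dvd e q ->
  eventually_dvd e (rmul p q) /\ eventually_dvd e (rmul q p).
Proof.
move=> [k kP]; split; exists k => n kn.
  exact: dvdp_mull (kP n kn).
exact: dvdp_mulr (kP n kn).
Qed.

Let germ_ideal_pred : A -> bool :=
  fun p => `[< eventually_dvd (fun k n => 2 ^ (n - k))%N p >].

Let germ_ideal_zmod : zmod_closed (germ_ideal_pred : {pred A}).
Proof.
by apply: eventually_dvd_zmod => k k' n kk'; rewrite leq_exp2l // leq_sub2l.
Qed.

Let germ_idealM (x y : A) : y \in (germ_ideal_pred : {pred A}) ->
  (rmul x y \in (germ_ideal_pred : {pred A})) /\
  (rmul y x \in (germ_ideal_pred : {pred A})).
Proof.
by move=> /asboolP /(@eventually_dvd_mul _ x)[? ?]; split; apply/asboolP.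
Qed.

(* At level [n] the variable stands for [x ^ (2 ^- n)], so that [x] is the
   sequence of the [2 ^ n]-th powers of the variable: [germ_ideal] is the
   idempotent ideal of positive order in [x] and [germ_ann] is [x] times it. *)
Definition germ_ideal : rngIdeal A := HB.pack germ_ideal_pred
  (GRing.isZmodClosed.Build A germ_ideal_pred germ_ideal_zmod)
  (isRngIdeal.Build A germ_ideal_pred germ_idealM).

Local Notation M := (ideal_rng germ_ideal).

Let germ_ann_pred : M -> bool :=
  fun p => `[< eventually_dvd (fun k n => 2 ^ n + 2 ^ (n - k))%N (val p) >].

Let germ_ann_zmod : zmod_closed (germ_ann_pred : {pred M}).
Proof.
have [|a0 aB] := @eventually_dvd_zmod (fun k n => 2 ^ n + 2 ^ (n - k))%N.
  by move=> k k' n kk'; rewrite leq_add2l leq_exp2l // leq_sub2l.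
by split=> [|p q pN qN]; [exact: a0 | exact: (aB _ _ pN qN)].
Qed.

Let germ_annM (x y : M) : y \in (germ_ann_pred : {pred M}) ->
  (rmul x y \in (germ_ann_pred : {pred M})) /\
  (rmul y x \in (germ_ann_pred : {pred M})).
Proof.
by move=> /asboolP /(@eventually_dvd_mul _ (val x))[? ?]; split; apply/asboolP.
Qed.

Definition germ_ann : rngIdeal M := HB.pack germ_ann_pred
  (GRing.isZmodClosed.Build M germ_ann_pred germ_ann_zmod)
  (isRngIdeal.Build M germ_ann_pred germ_annM).

Local Notation J := (quot_rng germ_ann).
Local Notation pi := (\pi_(Quotient.quot germ_ann)).

Definition const (a : L) : A := fun _ => a%:P.

Definition scale_ideal (a : L) (x : M) : M :=
  IdealRng (rng_idealMr (const a) (valP x)).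

Definition germ_scale (a : L) (u : J) : J := pi (scale_ideal a (repr u)).

Lemma pi_scale a x : germ_scale a (pi x) = pi (scale_ideal a x).
Proof.
apply/eqP; rewrite -Quotient.idealrBE.
have : repr (pi x) - x \in germ_ann by rewrite Quotient.idealrBE reprK.
move=> /asboolP /(@eventually_dvd_mul _ (const a))[+ _].
by rewrite raddfB => ?; apply/asboolP; rewrite raddfB /= -rmulBr.
Qed.

Lemma x_in_germ_ideal : (fun n => 'X^(2 ^ n)) \in germ_ideal.
Proof. by apply/asboolP; exists 0%N => n _; rewrite subn0. Qed.

Definition germ_x : J := pi (IdealRng x_in_germ_ideal).

(** The element [z] is the class of x: its order is exactly 1, so no nonzero scalar kills it, while
    its product with anything of positive order has order above 1 and vanishes in the quotient. *)
Lemma idempotent_ring_with_annihilator : exists (J : rngType)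
    (act : L -> J -> J) (z : J),
  [/\ rng_commutative J /\ rng_idempotent J,
      (forall a, {morph act a : u v / u + v}) /\
      (forall a b u, act (a + b) u = act a u + act b u),
      (forall a b u, act (a * b) u = act a (act b u)) /\
      (forall a u v, act a (rmul u v) = rmul (act a u) v),
      forall u, rmul z u = 0
    & forall a, act a z = 0 -> a = 0].
Proof.
have piM x y : pi (rmul x y) = rmul (pi x : J) (pi y : J) := pi_quot_mul _ x y.
have piD x y : pi (x + y) = pi x + pi y :> J := raddfD _ x y.
have sc_val a x n : val (scale_ideal a x) n = a%:P * val x n by [].
have valM (x y : M) n : val (rmul x y) n = val x n * val y n by [].
have valD (x y : M) n : val (x + y) n = val x n + val y n by [].
have val_eq (x y : M) : (forall n, val x n = val y n) -> x = y.
  by move=> xy; apply/val_inj/funext.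
have J0 (x : M) : (exists k, forall n, (k <= n)%N ->
    'X^(2 ^ n + 2 ^ (n - k)) %| val x n) -> pi x = 0 :> J.
  move=> x0; rewrite -(raddf0 pi); apply/eqP.
  by rewrite -Quotient.idealrBE subr0; apply/asboolP.
exists J, germ_scale, germ_x; split.
- split.
    move=> x y; rewrite -[x]reprK -[y]reprK -!piM; congr pi.
    by apply: val_eq => n; rewrite !valM mulrC.
  move=> u; rewrite -[u]reprK; move: (repr u) => x.
  have /asboolP[k kP] := valP x.
  (* [g] is x to the power 2 ^ -(k + 1). An element of order at least 2 ^ -k is divisible by the
     square of [g], hence is [g] times a multiple [h] of [g]. At levels up to [k], [h] is set to 0;
     only the tail matters. *)
  pose g : A := fun n => 'X^(2 ^ (n - k.+1)).
  pose h : A := fun n => if (k < n)%N then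
    'X^(2 ^ (n - k.+1)) * (val x n %/ 'X^(2 ^ (n - k))) else 0.
  have gM : g \in germ_ideal by apply/asboolP; exists k.+1.
  have hM : h \in germ_ideal.
    by apply/asboolP; exists k.+1 => n kn; rewrite /h kn dvdp_mulr.
  suff -> : pi x = rmul (pi (IdealRng gM) : J) (pi (IdealRng hM)).
    exact: in_square_mul.
  apply/eqP; rewrite -piM -subr_eq0 -raddfB; apply/eqP/J0.
  exists k.+1 => n kn.
  have -> : val (x - rmul (IdealRng gM) (IdealRng hM)) n
      = val x n - g n * h n by [].
  rewrite /g /h kn mulrA -exprD addnn -mul2n -expnS.
  rewrite (_ : (n - k.+1).+1 = n - k)%N; last by lia.
  by rewrite mulrC divpK ?kP ?subrr ?dvdp0 // ltnW.
- split=> [a u v|a b u]; rewrite -[u]reprK.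
    rewrite -[v]reprK -piD !pi_scale -piD; congr pi; apply: val_eq => n.
    by rewrite sc_val !valD mulrDr.
  rewrite !pi_scale -piD; congr pi; apply: val_eq => n.
  by rewrite valD !sc_val polyCD mulrDl.
- split=> [a b u|a u v]; rewrite -[u]reprK.
    rewrite (pi_scale b) !pi_scale; congr pi; apply: val_eq => n.
    by rewrite !sc_val polyCM mulrA.
  rewrite -[v]reprK -piM !pi_scale -piM; congr pi; apply: val_eq => n.
  by rewrite sc_val !valM mulrA.
- move=> u; rewrite -[u]reprK -piM; apply: J0.
  have /asboolP[k kP] := valP (repr u); exists k => n kn.
  by rewrite valM exprD dvdp_mul ?kP.
move=> a; rewrite pi_scale -(raddf0 pi) => /eqP.
rewrite -Quotient.idealrBE subr0 => /asboolP[k kP].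
apply/eqP; apply: contraT => a0.
(* At level n = k the required order is 2 ^ k + 1, one more than the degree of the monomial. *)
have := dvdp_leq _ (kP k (leqnn k)); rewrite sc_val mul_polyC.
rewrite scaler_eq0 negb_or a0 -size_poly_eq0 size_scale //
  !size_polyXn => /(_ _).
by rewrite subnn addn1 ltnn => /(_ isT).
Qed.

End PuiseuxGerms.

Lemma idempotent_extensions_no_derivations (K : fieldType) :
  idempotent_extensions_commutative K -> no_incomparable_derivations K.
Proof.
move=> Ka [L [iota [d1 [d2 [[d1D d1M] [d2D d2M] [d12 d21]]]]]].
have [J [act [z [[Jcomm Jidem] [actD actDl] [actM actMl] zJ z_free]]]] :=
  idempotent_ring_with_annihilator L.
have act0 a u : rmul (act a z) u = 0.
  by rewrite -actMl zJ (morph_zmod (actD a)).1.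
have [||||||||||R RJ Rcomm] := @cocycle_extension K J (fun a => act (iota a))
  (fun a b => act (d1 a * d2 b) z).
- by move=> a; apply: actD.
- by move=> a b u; rewrite rmorphD actDl.
- by move=> a b u; rewrite rmorphM actM.
- by move=> a; apply: actMl.
- by move=> a u v; rewrite Jcomm actMl Jcomm.
- by move=> a b c; rewrite d1D mulrDl actDl.
- by move=> a b c; rewrite d2D mulrDr actDl.
- move=> a b c; rewrite -!actM -!actDl d1M d2M; congr (act _ z); ring.
- by move=> a b u; apply: act0.
- by move=> a b u; rewrite Jcomm act0.
have {}Rcomm a b : d1 a * d2 b = d1 b * d2 a.
  apply/eqP; rewrite -subr_eq0; apply/eqP/z_free.
  have actB := (@morph_zmod L J (act^~ z) (fun a b => actDl a b z)).2.
  by rewrite actB Rcomm ?subrr //; apply: Ka Jcomm Jidem R RJ.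
(* Symmetry of the cocycle at such an [a] gives d1 b * d2 a = 0 for every [b], so [d1] vanishes
   identically, against incomparability. *)
have [a /not_implyP[d1a d2a]] : exists a, ~ (d1 a = 0 -> d2 a = 0).
  exact/existsNP.
apply: d21 => b d2b; have /eqP := Rcomm a b.
by rewrite d1a mul0r eq_sym mulf_eq0 => /orP[/eqP//|/eqP].
Qed.

(** * Dual numbers and extension of derivations *)

(* [(x, y)] stands for [x + y e] with [e ^+ 2 = 0]. *)
Definition dual (K : fieldType) : Type := (K * K)%type.

Section DualNumbers.
Variable K : fieldType.

HB.instance Definition _ := GRing.Zmodule.on (dual K).

Definition dual_mul (u v : dual K) : dual K :=
  (u.1 * v.1, u.1 * v.2 + u.2 * v.1).

Fact dual_mulA : associative dual_mul.
Proof. by move=> u v w; congr (_, _) => /=; ring. Qed.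
Fact dual_mulC : commutative dual_mul.
Proof. by move=> u v; congr (_, _) => /=; ring. Qed.
Fact dual_mul1 : left_id (1, 0) dual_mul.
Proof. by move=> [x y]; congr (_, _) => /=; ring. Qed.
Fact dual_mulDl : left_distributive dual_mul +%R.
Proof. by move=> u v w; congr (_, _) => /=; ring. Qed.
Fact dual_1_neq0 : (1, 0) != 0 :> dual K.
Proof. by apply/eqP => -[/eqP]; rewrite oner_eq0. Qed.

HB.instance Definition _ := GRing.Zmodule_isComNzRing.Build (dual K)
  dual_mulA dual_mulC dual_mul1 dual_mulDl dual_1_neq0.

Definition dual_std (u : dual K) : K := u.1.

Fact dual_std_zmod : zmod_morphism dual_std. Proof. by []. Qed.
Fact dual_std_monoid : monoid_morphism dual_std. Proof. by []. Qed.
HB.instance Definition _ :=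
  GRing.isZmodMorphism.Build (dual K) K dual_std dual_std_zmod.
HB.instance Definition _ :=
  GRing.isMonoidMorphism.Build (dual K) K dual_std dual_std_monoid.

Definition dual_const (a : K) : dual K := (a, 0).

Fact dual_const_zmod : zmod_morphism dual_const.
Proof. by move=> a b; congr (_, _); rewrite subr0. Qed.
Fact dual_const_monoid : monoid_morphism dual_const.
Proof. by split=> // a b; congr (_, _) => /=; ring. Qed.
HB.instance Definition _ :=
  GRing.isZmodMorphism.Build K (dual K) dual_const dual_const_zmod.
HB.instance Definition _ :=
  GRing.isMonoidMorphism.Build K (dual K) dual_const dual_const_monoid.

Lemma dual_mulE (u v : dual K) : u * v = (u.1 * v.1, u.1 * v.2 + u.2 * v.1).
Proof. by []. Qed.

Lemma dual_mulf_eq0 (u v : dual K) : dual_std u != 0 -> u * v = 0 -> v = 0.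
Proof.
case: u v => [a b] [c d] /= a0 [/eqP].
rewrite mulf_eq0 (negPf a0) => /eqP -> /eqP.
by rewrite mulr0 addr0 mulf_eq0 (negPf a0) => /eqP ->.
Qed.

(** The first-order Taylor formula q(x + ye) = q(x) + q'(x)ye, exact because e squares to 0; for the
    same reason only the standard part of q'(x) counts. *)
Lemma dual_horner_shift (q : {poly dual K}) x y :
  q.[(x, y) : dual K] =
  q.[(x, 0) : dual K] + (0, dual_std q^`().[(x, 0) : dual K] * y).
Proof.
elim/poly_ind: q => [|q c IH].
  by rewrite deriv0 !horner0 raddf0 mul0r add0r.
rewrite derivMXaddC !hornerMXaddC hornerD hornerMX IH.
case: q.[_] q^`().[_] c => [a b] [a' b'] [c1 c2]; rewrite !dual_mulE.
by congr (_, _) => /=; ring.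
Qed.

Lemma dual_std_horner (q : {poly dual K}) x y :
  dual_std q.[(x, y) : dual K] = dual_std q.[(x, 0) : dual K].
Proof. by rewrite dual_horner_shift raddfD /= addr0. Qed.

End DualNumbers.

(** * Adjoining one element to the domain of a derivation *)

Section Adjunction.
Variables (K : fieldType) (S : subringClosed (dual K)).
Hypothesis K0 : [pchar K] =i pred0.
Hypothesis S_graph : forall u, u \in S -> dual_std u = 0 -> u = 0.

(* [q] lifts the minimal polynomial of [x] over the domain of the derivation. *)
Lemma minimal_annihilator x :
    (exists q, [/\ q \is a polyOver S, q != 0 &
      dual_std q.[(x, 0) : dual K] = 0]) ->
  exists q, [/\ q \is a polyOver S, dual_std q.[(x, 0) : dual K] = 0,
    dual_std q^`().[(x, 0) : dual K] != 0 &
    forall r, r \is a polyOver S -> r != 0 ->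
      dual_std r.[(x, 0) : dual K] = 0 -> (size q <= size r)%N].
Proof.
move=> ex_q.
pose P n := `[< exists q, [/\ q \is a polyOver S, q != 0, size q = n &
  dual_std q.[(x, 0) : dual K] = 0] >].
have exP : exists n, P n.
  by case: ex_q => q [? ? ?]; exists (size q); apply/asboolP; exists q.
case: (ex_minnP exP) => n /asboolP[q [qS q0 qn qx]] n_min.
have q_min r : r \is a polyOver S -> r != 0 ->
    dual_std r.[(x, 0) : dual K] = 0 -> (size q <= size r)%N.
  by move=> rS r0 rx; rewrite qn; apply: n_min; apply/asboolP; exists r.
exists q; split=> //; apply/eqP => dqx.
(* By minimality, a derivative vanishing at [x] must be 0. In characteristic zero this forces the
   leading coefficient to have standard part 0, hence to be 0 as an element of a graph. *)
have dq0 : q^`() = 0.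
  apply: contrapT => /eqP dq0.
  have := q_min _ (polyOver_deriv qS) dq0 dqx.
  by rewrite leqNgt lt_size_deriv.
have [q1|q1] := leqP (size q) 1.
  move: qx q0 qS; rewrite (size1_polyC q1) hornerC polyC_eq0 => cx.
  by move=> /eqP c0 /polyOverP/(_ 0%N); rewrite coefC => /S_graph/(_ cx)/c0.
have := congr1 (fun p : {poly dual K} => dual_std p`_(size q).-2) dq0.
rewrite coef_deriv coef0 raddfMn raddf0 /= prednK -?subn1 ?ltn_subRL ?addn0 //.
rewrite subn1 -lead_coefE => /eqP; rewrite -mulr_natr mulf_eq0.
rewrite (proj1 (pcharf0P K) K0) -subn1 subn_eq0 leqNgt q1 orbF => /eqP lq0.
have /S_graph/(_ lq0)/eqP : lead_coef q \in S by rewrite lead_coefE (polyOverP qS).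
by rewrite lead_coef_eq0 (negPf q0).
Qed.

(** The value [y] of the derivation at [x] is arbitrary if [x] is transcendental over its domain.
    Otherwise it is dictated by the minimal [q], and pseudo-division by [q] handles every other
    [g]. *)
Lemma adjoin_dual x : exists y, forall g, g \is a polyOver S ->
  dual_std g.[(x, y) : dual K] = 0 -> g.[(x, y) : dual K] = 0.
Proof.
have [ex_q|no_q] := pselect (exists q,
    [/\ q \is a polyOver S, q != 0 & dual_std q.[(x, 0) : dual K] = 0]); last first.
  exists 0 => g gS gx; apply: contrapT => g0; case: no_q; exists g; split=> //.
  by apply/eqP => gE; apply: g0; rewrite gE horner0.
have [q [qS qx dqx q_min]] := minimal_annihilator ex_q.
(* The solution of q(x + ye) = 0 given by the Taylor formula. *)
pose y := - q.[(x, 0) : dual K].2 / dual_std q^`().[(x, 0) : dual K].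
have qy : q.[(x, y) : dual K] = 0.
  rewrite dual_horner_shift; move: qx; rewrite /y.
  move: q.[_] q^`().[_] dqx => [a b] [a' b'] /= a'0 ->.
  by congr (_, _) => /=; rewrite ?addr0 // mulrC divfK // subrr.
exists y => g; have [n] := ubnP (size g); elim: n => // n IHn in g *.
rewrite ltnS => gn gS gx; have [->|g0] := eqVneq g 0; first by rewrite horner0.
have qg : (size q <= size g)%N 
  by apply: q_min => //; rewrite -(dual_std_horner _ _ y).
have q0 : q != 0.
  by apply: contraNneq dqx => ->; rewrite deriv0 horner0.
(* One step of pseudo-division. The dual numbers are not a domain, but [lead_coef q] can be
   cancelled: it is nonzero and in [S], so its standard part is nonzero. *)
pose h := lead_coef q *: g - lead_coef g *: ('X^(size g - size q) * q).
have hy : h.[(x, y) : dual K] = lead_coef q * g.[(x, y) : dual K].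
  by rewrite /h hornerD hornerN !hornerZ hornerM qy !mulr0 subr0.
have lS p : p \is a polyOver S -> lead_coef p \in S.
  by move=> /polyOverP pS; rewrite lead_coefE.
have hS : h \is a polyOver S.
  by rewrite rpredB // polyOverZ ?lS // rpredM // rpredX // polyOverX.
apply: (@dual_mulf_eq0 _ (lead_coef q)).
  by apply: contra_neq q0 => lq0; apply/eqP;
    rewrite -lead_coef_eq0 (S_graph (lS q qS)).
rewrite -hy; apply: IHn => //; last by rewrite hy rmorphM /= gx mulr0.
apply: leq_trans gn.
have sg : (0 < size g)%N by rewrite size_poly_gt0.
have sq : (0 < size q)%N by rewrite size_poly_gt0.
rewrite -(prednK sg) ltnS; apply/leq_sizeP => j gj.
have gqj : (size g - size q <= j)%N by lia.
rewrite coefB !coefZ coefXnM ltnNge gqj /=.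
have [->|jg] := eqVneq j (size g).-1.
  rewrite (_ : (size g).-1 - (size g - size q) = (size q).-1)%N; last by lia.
  by rewrite -!lead_coefE mulrC subrr.
have gj' : (size g <= j)%N by rewrite -(prednK sg) ltn_neqAle eq_sym jg.
have qj : (size q <= j - (size g - size q))%N by lia.
by rewrite !nth_default // !mulr0 subrr.
Qed.

End Adjunction.

(** * Extension of derivations to the whole field *)

Section DerivationExtension.
Variables (K : fieldType).
Hypothesis K0 : [pchar K] =i pred0.

(** Closure of the graph under dual multiplication is the Leibniz rule: (x, dx)(y, dy) = (xy, x dy +
    dx y). *)
Lemma derivation_of_graph (G : set (dual K)) :
    (forall x, exists y, G (x, y)) -> (forall u v, G u -> G v -> G (u - v)) ->
    (forall u v, G u -> G v -> G (u * v)) ->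
    (forall u, G u -> dual_std u = 0 -> u = 0) ->
  exists2 d : K -> K, derivation idfun d & forall u, G u -> d u.1 = u.2.
Proof.
move=> Gtot GB GM G0; have [d dG] := boolp.choice Gtot.
have dE u : G u -> d u.1 = u.2.
  case: u => x y Gxy /=.
  have /G0 : G ((x, d x) - (x, y) : dual K) by apply: GB.
  by rewrite raddfB /= subrr => /(_ erefl)[_ /eqP]; rewrite subr_eq0 => /eqP.
exists d => //; split=> x y.
  have G00 : G 0 by rewrite -(subrr (x, d x)); apply: GB.
  have GN u : G u -> G (- u) by move=> Gu; rewrite -[- u]sub0r; apply: GB.
  have := dE _ (GB _ _ (dG x) (GN _ (dG y))).
  by rewrite opprK.
exact: dE (GM _ _ (dG x) (dG y)).
Qed.

Lemma derivation_extension (G0 : set (dual K)) :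
    G0 1 -> (forall u v, G0 u -> G0 v -> G0 (u - v)) ->
    (forall u v, G0 u -> G0 v -> G0 (u * v)) ->
    (forall u, G0 u -> dual_std u = 0 -> u = 0) ->
  exists2 d : K -> K, derivation idfun d & forall u, G0 u -> d u.1 = u.2.
Proof.
move=> G01 G0B G0M G0_graph.
(* [G0] has to be included only once [W] is inhabited, so that the empty union in Zorn's lemma
   qualifies. *)
pose good (W : set (dual K)) :=
  [/\ forall u v, W u -> W v -> W (u - v), forall u v, W u -> W v -> W (u * v),
     forall u, W u -> dual_std u = 0 -> u = 0
   & forall u, W u -> (G0 `<=` W)%classic].
have [F Fgood Ftot|W [[WB WM W_graph WG0] Wmax]] := @Zorn_bigcup (dual K) good.
  have Fpair u v :
      (\bigcup_(X in F) X)%classic u -> (\bigcup_(X in F) X)%classic v ->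
      exists X, [/\ F X, X u & X v].
    move=> [X FX Xu] [Y FY Yv]; have [XY|YX] := Ftot X Y FX FY.
      by exists Y; split=> //; apply: XY.
    by exists X; split=> //; apply: YX.
  split=> [u v Fu /(Fpair _ _ Fu)[X [FX Xu Xv]]|
    u v Fu /(Fpair _ _ Fu)[X [FX Xu Xv]]|u [X FX Xu]|u [X FX Xu] w G0w].
  - by exists X => //; have [XB _ _ _] := Fgood X FX; apply: XB.
  - by exists X => //; have [_ XM _ _] := Fgood X FX; apply: XM.
  - by have [_ _ X_graph _] := Fgood X FX; apply: X_graph.
  - by exists X => //; have [_ _ _ XG0] := Fgood X FX; apply: XG0 Xu _ _.
have {WG0}G0W : (G0 `<=` W)%classic.
  have [[w Ww]|Wno] := pselect (exists w, W w); first exact: WG0 Ww.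
  have W0 w : ~ W w by move=> Ww; apply: Wno; exists w.
  have G0good : good G0 by split=> // u _ w.
  case: (Wmax G0) => //.
  by split=> [w /W0//|G0W]; apply: (W0 1); apply: G0W.
pose Wp : dual K -> bool := fun u => `[< W u >].
have W_subring : subring_closed (Wp : {pred dual K}).
  split=> [|u v /asboolP Wu /asboolP Wv|u v /asboolP Wu /asboolP Wv].
  - by apply/asboolP/G0W.
  - by apply/asboolP/WB.
  - by apply/asboolP/WM.
pose S : subringClosed (dual K) :=
  HB.pack Wp (GRing.isSubringClosed.Build (dual K) Wp W_subring).
have SW u : u \in S <-> W u by split=> [/asboolP//|Wu]; apply/asboolP.
have S_graph u : u \in S -> dual_std u = 0 -> u = 0 by move/SW; apply: W_graph.
have Wtot x : exists y, W (x, y).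
  have [y y_graph] := adjoin_dual K0 S_graph x; exists y.
  (* The ring obtained by adjoining (x, y) to [W]; it is again a graph by the choice of [y]. *)
  pose W' : set (dual K) := fun u =>
    exists2 g : {poly dual K}, g \is a polyOver S & u = g.[(x, y) : dual K].
  have WW' : (W `<=` W')%classic.
    by move=> w /SW Ww; exists w%:P; rewrite ?polyOverC ?hornerC.
  have W'xy : W' (x, y) by exists 'X; rewrite ?polyOverX ?hornerX.
  apply: contrapT => nWxy; apply: (Wmax W').
    by split=> // /(_ _ W'xy).
  split=> [u v [g gS ->] [h hS ->]|u v [g gS ->] [h hS ->]|u [g gS ->]|u _ w G0w].
  - by exists (g - h); rewrite ?rpredB ?hornerD ?hornerN.
  - by exists (g * h); rewrite ?rpredM ?hornerM.
  - exact: y_graph.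
  - exact/WW'/G0W.
have [d d_der dE] := derivation_of_graph Wtot WB WM W_graph.
by exists d => // u /G0W; apply: dE.
Qed.

End DerivationExtension.

(** * Derivations and algebraic independence *)

Section PrimeSubfield.
Variable K : fieldType.

Let prime_pred : K -> bool := fun x => `[< prime_subfield x >].

Let prime_pred_closed : GRing.divring_closed (prime_pred : {pred K}).
Proof.
split=> [|x y /asboolP xP /asboolP yP|x y /asboolP xP /asboolP yP];
  apply/asboolP => S S_closed; have [S1 SB SV] := S_closed => //.
  by apply: SB; [apply: xP | apply: yP].
by apply: SV; [apply: xP | apply: yP].
Qed.

Definition prime_closed : divringClosed K := HB.pack prime_pred
  (GRing.isDivringClosed.Build K prime_pred prime_pred_closed).

Lemma prime_closedP x : reflect (prime_subfield x) (x \in prime_closed).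
Proof. exact: asboolP. Qed.

End PrimeSubfield.

Section DerivationTheory.
Variables (K L : fieldType) (iota : {rmorphism K -> L}) (D : K -> L).
Hypothesis D_der : derivation iota D.

Lemma derivationD : {morph D : x y / x + y}. Proof. by case: D_der. Qed.

Lemma derivationM x y : D (x * y) = iota x * D y + D x * iota y.
Proof. by case: D_der. Qed.

Lemma derivation0 : D 0 = 0. Proof. exact: (morph_zmod derivationD).1. Qed.

Lemma derivation1 : D 1 = 0.
Proof.
apply: (addrI (D 1)); have := derivationM 1 1.
by rewrite mulr1 rmorph1 mul1r mulr1 addr0 => <-.
Qed.

(** The kernel of a derivation is a subfield. *)
Lemma derivation_prime x : prime_subfield x -> D x = 0.
Proof.
move=> /(_ (fun y => D y == 0)) xP; apply/eqP/xP.
split=> [|y z /eqP Dy /eqP Dz|y z /eqP Dy /eqP Dz]; rewrite /in_mem /=.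
- by rewrite derivation1.
- by rewrite (morph_zmod derivationD).2 Dy Dz subrr.
have [->|z0] := eqVneq z 0; first by rewrite invr0 mulr0 derivation0.
rewrite derivationM Dy mul0r addr0.
have /eqP := derivationM z z^-1; rewrite mulfV // derivation1 Dz mul0r addr0.
by rewrite eq_sym mulf_eq0 fmorph_eq0 (negPf z0) => /eqP ->; rewrite mulr0.
Qed.

(** The chain rule: there is no contribution from the coefficients, which [D] kills. The formula
    holds for constants and variables and passes to sums and products. *)
Lemma derivation_meval n (v : 'I_n -> K) (p : {mpoly K[n]}) :
    p \is a mpolyOver n (prime_closed K) ->
  D p.@[v] = \sum_(i < n) iota (p^`M(i)).@[v] * D (v i).
Proof.
move=> /mpolyOverP pP.
pose Q q := D q.@[v] = \sum_(i < n) iota (q^`M(i)).@[v] * D (v i).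
have QM q r : Q q -> Q r -> Q (q * r).
  rewrite /Q mevalM derivationM => -> ->.
  rewrite mulr_sumr mulr_suml -big_split.
  apply: eq_bigr => i _; rewrite /= mderivM mevalD !mevalM rmorphD !rmorphM; ring.
have QC c : D c = 0 -> Q c%:MP.
  by rewrite /Q mevalC => ->; rewrite big1 // => i _;
    rewrite mderivC meval0 rmorph0 mul0r.
have QXU i : Q 'X_i.
  rewrite /Q mevalXU (bigD1 i) //= big1 => [|j ji]; rewrite mderivX mevalZ mnm1E.
    rewrite eqxx mul1r -{1}[U_(i)%MM]add0m addmK mpolyX0 meval1 rmorph1.
    by rewrite mul1r addr0.
  by rewrite eq_sym (negPf ji) mul0r rmorph0 mul0r.
have Q1 : Q 1 by apply: QC derivation1.
rewrite -/(Q p) [p]mpolyE; apply: (big_ind Q) => [|q r|m _].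
- exact: QC derivation0.
- rewrite /Q mevalD derivationD => -> ->; rewrite -big_split.
  by apply: eq_bigr => i _; rewrite /= mderivD mevalD rmorphD mulrDl.
rewrite -mul_mpolyC; apply: (QM); first by apply/QC/derivation_prime/prime_closedP.
rewrite mpolyXE_id; apply: (big_ind Q) => [//|q r|i _]; first exact: QM.
by elim: (m i) => // k IHk; rewrite exprS; apply: QM.
Qed.

End DerivationTheory.

(** * Algebraic independence and transcendence degree in characteristic zero *)

Section Independence.
Variable K : fieldType.

Lemma independent0 (F : K -> Prop) : alg_independent F (fun x => x \in [::]).
Proof.
move=> [|n] v _ vB p _; last by have := vB ord0.
have -> : p = (p@_0%MM)%:MP.
  apply/mpolyP => m; have -> : m = 0%MM by apply/mnmP => -[].
  by rewrite mcoeffC eqxx mulr1.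
by rewrite mevalC => ->.
Qed.

Lemma independent_sub (F B B' : K -> Prop) :
  (forall x, B x -> B' x) -> alg_independent F B' -> alg_independent F B.
Proof. by move=> BB' B'_ind n v v_inj vB; apply: B'_ind => // i; apply: BB'. Qed.

Lemma independent_eliminate (B : K -> Prop) n (v : 'I_n -> K) i0
    (p : {mpoly K[n]}) :
    alg_independent (@prime_subfield K) B ->
    injective v -> (forall i, i != i0 -> B (v i)) ->
    p \is a mpolyOver n (prime_closed K) -> p.@[v] = 0 ->
    (forall m, m \in msupp p -> m i0 = 0%N) ->
  p = 0.
Proof.
case: n v i0 p => [|n] v i0 p; first by case: i0.
move=> B_ind v_inj vB /mpolyOverP pP pv p_i0.
(* [r] forgets the exponent at [i0]. That exponent is 0 throughout the support, so [r] is injective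
   there and [p'] keeps the coefficients of [p]. *)
pose r (m : 'X_{1..n.+1}) := [multinom m (lift i0 j) | j < n].
pose p' := \sum_(m <- msupp p) p@_m *: 'X_[K, r m].
have p'E m : m \in msupp p -> p'@_(r m) = p@_m.
  move=> mp; rewrite /p' raddf_sum /= (bigD1_seq m) ?msupp_uniq //=.
  rewrite mcoeffZ mcoeffX eqxx mulr1 big_seq_cond big1 ?addr0 // => m'.
  case/andP=> m'p; apply: contraNeq; rewrite mcoeffZ mcoeffX.
  case: (r m' =P r m) => [rmm' _|_]; last by rewrite mulr0 eqxx.
  apply/eqP/mnmP => i; have [j ->|->] := unliftP i0 i; last by rewrite !p_i0.
  by have := congr1 (fun s : 'X_{1..n} => s j) rmm'; rewrite !mnmE.
suff p'0 : p' = 0.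
  apply/mpolyP => m; rewrite mcoeff0.
  have [mp|/memN_msupp_eq0//] := boolP (m \in msupp p).
  by rewrite -p'E // p'0 mcoeff0.
apply: (B_ind n (v \o lift i0)).
- by move=> i j /v_inj/lift_inj.
- by move=> j; apply: vB; rewrite eq_sym neq_lift.
- move=> m; apply/prime_closedP; move: m; apply/mpolyOverP.
  by apply: rpred_sum => m _; rewrite mpolyOverZ ?mpolyOverX.
rewrite -[RHS]pv /p' raddf_sum mevalE big_seq [RHS]big_seq.
apply: eq_bigr => m mp; rewrite /= mevalZ mevalX; congr (_ * _).
rewrite [RHS](bigD1_ord i0) //= p_i0 // expr0 mul1r.
by apply: eq_bigr => j _; rewrite mnmE.
Qed.

Hypothesis K0 : [pchar K] =i pred0.

(** Applying [D] to a relation p(v) = 0 leaves only the term at the variable of [x], so the partial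
    derivative there is again a relation, of lower degree in that variable. By induction it is 0; in
    characteristic zero [p] then omits the variable and is a relation over [B]. *)
Lemma independent_adjoin (L : fieldType) (iota : {rmorphism K -> L}) D
    (B : K -> Prop) x :
    derivation iota D -> (forall y, B y -> D y = 0) -> D x != 0 ->
    alg_independent (@prime_subfield K) B ->
  alg_independent (@prime_subfield K) (fun y => B y \/ y = x).
Proof.
move=> D_der DB Dx B_ind n v v_inj vB p pP pv.
have [[i0 vi0]|no_x] := pselect (exists i0, v i0 = x); last first.
  apply: B_ind pv => // i.
  by have [//|vix] := vB i; case: no_x; exists i.
have vB' i : i != i0 -> B (v i).
  by have [//|vix] := vB i => /eqP[]; apply: v_inj; rewrite vix vi0.
have {}pP : p \is a mpolyOver n (prime_closed K).
  by apply/mpolyOverP => m; apply/prime_closedP.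
have [k p_lt] : exists k, forall m, m \in msupp p -> (m i0 < k)%N.
  exists (\max_(m <- msupp p) (m i0)).+1 => m mp; rewrite ltnS.
  by apply: (@leq_bigmax_seq _ _ xpredT (fun m : 'X_{1..n} => m i0)).
elim: k => [|k IHk] in p pP pv p_lt *.
  by apply/eqP; rewrite -msupp_eq0; case: (msupp p) p_lt => // m s /(_ m (mem_head _ _)).
have dp0 : p^`M(i0) = 0.
  apply: IHk.
  - apply/mpolyOverP => m; rewrite mcoeff_mderiv rpredMn //.
    by move/mpolyOverP: pP.
  - have := derivation_meval D_der v pP.
    rewrite pv (derivation0 D_der) (bigD1 i0) //= big1 => [/esym/eqP|i /vB'/DB ->].
      by rewrite vi0 addr0 mulf_eq0 (negPf Dx) orbF fmorph_eq0 => /eqP.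
    by rewrite mulr0.
  move=> m; rewrite mcoeff_msupp mcoeff_mderiv => dpm.
  have /p_lt : (m + U_(i0))%MM \in msupp p.
    by rewrite mcoeff_msupp; apply: contra_neq dpm => ->; rewrite mul0rn.
  by rewrite mnmDE mnm1E eqxx addn1.
apply: independent_eliminate B_ind v_inj vB' pP pv _ => m mp.
apply/eqP; apply: contraTT mp => mi0.
have /submK mE : (U_(i0) <= m)%MM by rewrite lep1mP.
have := congr1 (mcoeff (m - U_(i0))%MM) dp0; rewrite mcoeff_mderiv mcoeff0 mE.
move=> /eqP; rewrite -mulr_natr mulf_eq0 (proj1 (pcharf0P K) K0) orbF => /eqP pm.
by rewrite mcoeff_msupp pm eqxx.
Qed.

(** Polynomials over the prime subfield, evaluated at the dual numbers (v i, w i), form a ring.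
    Independence makes it a graph: a value with standard part p(v) = 0 comes from p = 0. *)
Lemma independent_derivation (B : K -> Prop) n (v w : 'I_n -> K) :
    alg_independent (@prime_subfield K) B ->
    injective v -> (forall i, B (v i)) ->
  exists2 d : K -> K, derivation idfun d & forall i, d (v i) = w i.
Proof.
move=> B_ind v_inj vB.
pose ev (p : {mpoly K[n]}) : dual K :=
  mmap (@dual_const K) (fun i => (v i, w i) : dual K) p.
have std_ev p : dual_std (ev p) = p.@[v].
  rewrite /ev /mmap rmorph_sum mevalE; apply: eq_bigr => m _.
  rewrite rmorphM /mmap1 rmorph_prod; congr (_ * _).
  by apply: eq_bigr => i _; rewrite rmorphXn.
pose G u := exists2 p, p \is a mpolyOver n (prime_closed K) & u = ev p.
have [||||d d_der dG] := @derivation_extension K K0 G.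
- by exists 1; rewrite ?rpred1 // /ev rmorph1.
- by move=> _ _ [p pP ->] [q qP ->]; exists (p - q); rewrite ?rpredB // /ev rmorphB.
- by move=> _ _ [p pP ->] [q qP ->]; exists (p * q); rewrite ?rpredM // /ev rmorphM.
- move=> _ [p /mpolyOverP pP ->]; rewrite std_ev => pv.
  rewrite (B_ind n v v_inj vB p _ pv) /ev ?rmorph0 // => m.
  exact/prime_closedP.
exists d => // i; apply: (dG (v i, w i)); exists 'X_i; first exact: mpolyOverX.
by rewrite /ev mmapX mmap1U.
Qed.

Lemma trdeg_le1_of_no_incomparable_derivations :
  no_incomparable_derivations K ->
  exists n : nat, (n <= 1)%N /\ has_trdeg (@prime_subfield K) n.
Proof.
move=> Kc; apply: contrapT => no_deg; apply: Kc.
(* An independent family of size at most 1 is not a basis, so it can be enlarged; doing so twice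
   gives independent [a] and [b]. *)
have extend (s : seq K) : uniq s -> (size s <= 1)%N ->
    alg_independent (@prime_subfield K) (fun x => x \in s) ->
    exists B x, [/\ alg_independent (@prime_subfield K) B,
      forall y, y \in s -> B y, B x & x \notin s].
  move=> s_uniq s1 s_ind; apply: contrapT => no_B; apply: no_deg.
  exists (size s); split=> //; exists s; split=> //; split=> // B B_ind sB x Bx.
  by apply: contrapT => xs; apply: no_B; exists B, x; split=> //; apply/negP.
have [B [a [B_ind _ Ba _]]] := extend [::] isT isT (@independent0 _).
have [|B' [b [B'_ind aB' B'b ba]]] := extend [:: a] isT isT.
  by apply: independent_sub B_ind => x; rewrite inE => /eqP ->.
have {}aB' := aB' a (mem_head _ _); move: ba; rewrite inE => ba.
pose v (i : 'I_2) := if i == 0 then a else b.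
have v_inj : injective v.
  move=> i j; rewrite /v; case: i j => [[|[|//]] ?] [[|[|//]] ?] /= e;
    apply: val_inj => //=; by rewrite e eqxx in ba.
have vB' i : B' (v i) by rewrite /v; case: ifP.
have der w := independent_derivation w B'_ind v_inj vB'.
(* [d1] and [d2] are dual to [a] and [b]: each kills one of the two elements and takes the value 1
   at the other. *)
have [d1 d1_der d1v] := der (fun i => (i == 0)%:R).
have [d2 d2_der d2v] := der (fun i => (i != 0)%:R).
exists K, idfun, d1, d2; split=> //; split.
  by move/(_ _ (d1v 1)); rewrite d2v => /eqP; rewrite oner_eq0.
by move/(_ _ (d2v 0)); rewrite d1v => /eqP; rewrite oner_eq0.
Qed.

Lemma derivation_combination (L : fieldType) (iota : {rmorphism K -> L}) d1 d2
    (a b : L) :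
  derivation iota d1 -> derivation iota d2 ->
  derivation iota (fun x => a * d1 x - b * d2 x).
Proof.
move=> [d1D d1M] [d2D d2M]; split=> x y; first by rewrite d1D d2D; ring.
by rewrite d1M d2M; ring.
Qed.

Lemma no_incomparable_derivations_of_trdeg_le1 n :
  (n <= 1)%N -> has_trdeg (@prime_subfield K) n -> no_incomparable_derivations K.
Proof.
move=> n1 [s [_ sn [s_ind s_max]]] [L [iota [d1 [d2 [d1_der d2_der [d12 d21]]]]]].
have s_der D :
    derivation iota D -> (forall y, y \in s -> D y = 0) -> forall x, D x = 0.
  move=> D_der Ds x; apply: contrapT => /eqP Dx.
  have ind := independent_adjoin D_der Ds Dx s_ind.
  have /Ds/eqP := s_max _ ind (fun y => @or_introl _ _) x (or_intror erefl).
  by rewrite (negPf Dx).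
(* For an empty basis, [t] is the dummy value 0. *)
have [t ts] : exists t, forall y, y \in s -> y = t.
  case: s sn {s_ind s_max s_der} => [|t [|t' s]] sn; first by exists 0.
    by exists t => y; rewrite inE => /eqP.
  by move: n1; rewrite -sn.
(* The combination d2 t * d1 - d1 t * d2 is a derivation vanishing on the basis, hence
   everywhere. *)
have d_prop x : d2 t * d1 x = d1 t * d2 x.
  apply/eqP; rewrite -subr_eq0; apply/eqP.
  apply: (s_der _ (derivation_combination _ _ d1_der d2_der) _ x) => y /ts ->.
  by rewrite mulrC subrr.
have [a /not_implyP[d1a d2a]] : exists a, ~ (d1 a = 0 -> d2 a = 0).
  exact/existsNP.
(* Proportionality at [a] forces [d1] to vanish at [t], hence identically, which contradicts
   [d21]. *)
have d1t : d1 t = 0.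
  have /eqP := d_prop a; rewrite d1a mulr0 eq_sym mulf_eq0.
  by case/orP=> /eqP.
apply: d21 => x _; apply: s_der d1_der _ x => y /ts -> //.
Qed.

End Independence.

Local Close Scope quotient_scope.
Local Close Scope ring_scope.

Theorem corollary2 :
  (forall K : fieldType,
    (idempotent_extensions_commutative K <->
     central_extensions_commutative K) /\
    (central_extensions_commutative K <-> no_incomparable_derivations K)) /\
  (forall K : fieldType, [pchar K]%R =i pred0 ->
    (no_incomparable_derivations K <->
     exists n : nat, n <= 1 /\ has_trdeg (@prime_subfield K) n)).
Proof.
split=> K.
  have ac := @idempotent_extensions_no_derivations K.
  have cb := @no_incomparable_derivations_central K.
  have ba := @central_extensions_idempotent K.
  split; first by split=> [/ac/cb|/ba].
  by split=> [/ba/ac|/cb].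
move=> K0; split; first exact: trdeg_le1_of_no_incomparable_derivations.
by case=> n [n1 n_deg]; apply: no_incomparable_derivations_of_trdeg_le1 n_deg.
Qed.
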